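(* Let $n\ge1$ and $k,l,m$ be positive integers with $\gcd(k,l,m,n)=1$, and let $\tau_{k,l,m}(n)$ be the number of spanning trees of $Y(n;k,l,m)$. Put $s=k+l+m-1$ and $$Q(w)=\frac{(3-2T_k(w))(3-2T_l(w))(3-2T_m(w))}{w-1}\left(3-\frac{1}{3-2T_k(w)}-\frac{1}{3-2T_l(w)}-\frac{1}{3-2T_m(w)}\right),$$ which is a polynomial of degree $s$; let $w_1,\ldots,w_s$ be its roots (with multiplicity). Then $$\tau_{k,l,m}(n)=\frac{n\,3^{n}}{k^2+l^2+m^2}\prod_{p=1}^{s}|2T_n(w_p)-2|.$$
   Context: $T_j(w)$ denotes the Chebyshev polynomial of the first kind, $T_j(\cos\varphi)=\cos(j\varphi)$. The $Y$-graph $Y(n;k,l,m)$ is the (multi)graph with vertices $v_{x,y}$, $x\in\{0,1,2,3\}$, $y\in\mathbb{Z}_n$, and edges $v_{1,y}v_{1,y+k}$, $v_{2,y}v_{2,y+l}$, $v_{3,y}v_{3,y+m}$ and $v_{i,y}v_{0,y}$ ($i=1,2,3$) for all $y\in\mathbb{Z}_n$, indices mod $n$. The condition $\gcd(k,l,m,n)=1$ is exactly connectedness of this graph. *)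

(* Defs.v *)
From HB Require Import structures.
From mathcomp Require Import all_boot all_order all_algebra.
From mathcomp Require Import boolp reals trigo ring.

Set Implicit Arguments.
Unset Strict Implicit.
Unset Printing Implicit Defensive.

Import Order.TTheory GRing.Theory Num.Theory.

(* Finite multigraphs; loops and parallel edges are allowed.  The order of the
   two components of [ends e] is irrelevant to every notion below. *)
Record multigraph := Multigraph {
  vertex : finType;
  edge : finType;
  ends : edge -> vertex * vertex
}.

Section Multigraph.
Variable G : multigraph.

(* An edge together with a direction of traversal: [false] goes from the first
   component of [ends e] to the second, [true] goes backwards. *)
Definition dart : Type := edge G * bool.

Definition dart_src (d : dart) : vertex G :=
  if d.2 then (ends d.1).2 else (ends d.1).1.

Definition dart_tgt (d : dart) : vertex G :=
  if d.2 then (ends d.1).1 else (ends d.1).2.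

Definition adjacent (S : {set edge G}) : rel (vertex G) :=
  fun u v => [exists e in S, (ends e == (u, v)) || (ends e == (v, u))].

Definition spans_connected (S : {set edge G}) : Prop :=
  forall u v : vertex G, connect (adjacent S) u v.

(* A graph-theoretic cycle with all edges in [S]: a nonempty closed walk with
   no repeated edge and no repeated vertex.  A loop is a cycle of length 1 and
   two parallel edges form a cycle of length 2. *)
Definition is_cycle_in (S : {set edge G}) (c : seq dart) : Prop :=
  [/\ c != [::],
      cycle (fun d d' : dart => dart_tgt d == dart_src d') c,
      uniq [seq d.1 | d <- c],
      uniq [seq dart_src d | d <- c]
    & all (fun d : dart => d.1 \in S) c].

Definition acyclic (S : {set edge G}) : Prop :=
  forall c : seq dart, ~ is_cycle_in S c.

(* The subgraph with edge set [S] and all the vertices of [G] is a tree. *)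
Definition spanning_tree (S : {set edge G}) : Prop :=
  spans_connected S /\ acyclic S.

Definition num_spanning_trees : nat :=
  #|[set S : {set edge G} | `[< spanning_tree S >]]|.

End Multigraph.

Section YGraph.
Variables n k l m : nat.

(* Z_n is represented by 'I_n rather than 'Z_n, because 'Z_1 is Z/2. *)
Definition shift_mod (y : 'I_n) (j : nat) : 'I_n :=
  Ordinal (ltn_pmod (y + j) (leq_ltn_trans (leq0n y) (ltn_ord y))).

Definition Yjump (i : 'I_3) : nat := tnth [tuple k; l; m] i.

(* The vertex v_{x,y} is the pair (x, y).  For i = 0, 1, 2, the edge
   [inl (i, y)] joins v_{i+1,y} to v_{i+1,y+j}, where j is the i-th jump, and
   the edge [inr (i, y)] joins v_{i+1,y} to v_{0,y}.  Edges are indexed by y,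
   hence counted with multiplicity when they coincide as pairs of vertices. *)
Definition Yends (e : 'I_3 * 'I_n + 'I_3 * 'I_n) :
    ('I_4 * 'I_n) * ('I_4 * 'I_n) :=
  match e with
  | inl (i, y) => ((lift ord0 i, y), (lift ord0 i, shift_mod y (Yjump i)))
  | inr (i, y) => ((lift ord0 i, y), (ord0, y))
  end.

Definition Ygraph : multigraph := Multigraph Yends.

End YGraph.

Local Open Scope ring_scope.

Fixpoint chebT (R : nzRingType) (j : nat) {struct j} : {poly R} :=
  match j with
  | 0 => 1
  | 1 => 'X
  | (j'.+1 as j1).+1 => 2 *: ('X * chebT R j1) - chebT R j'
  end.

Lemma chebT_cos (R : realType) (j : nat) (phi : R) :
  (chebT R j).[cos phi] = cos (j%:R * phi).
Proof.
suff: (chebT R j).[cos phi] = cos (j%:R * phi) /\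
      (chebT R j.+1).[cos phi] = cos (j.+1%:R * phi) by case.
elim: j => [|j [IH0 IH1]].
  by split; [rewrite /= hornerE mul0r cos0 | rewrite /= hornerX mul1r].
split=> //.
have -> : chebT R j.+2 = 2 *: ('X * chebT R j.+1) - chebT R j by [].
rewrite hornerD hornerN hornerZ -commr_polyX hornerMX IH0.
have <- : j.+1%:R * phi + phi = j.+2%:R * phi.
  by rewrite -[j.+2]addn1 natrD mulrDl mul1r.
have {1}-> : j%:R * phi = j.+1%:R * phi - phi.
  by rewrite -addn1 natrD mulrDl mul1r addrK.
rewrite IH1; set t := j.+1%:R * phi.
by rewrite cosB cosD; ring.
Qed.

(* The rational function 3 - 2 T_j(w), in the field of fractions of C[w].  The
   complex numbers are abstracted to an arbitrary numClosedFieldType C, which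
   covers both R[i] for a real closed field R and algC. *)
Definition chebA (C : numClosedFieldType) (j : nat) : {fraction {poly C}} :=
  FracField.tofrac (3 - 2 *: chebT C j).

Definition Yfrac (C : numClosedFieldType) (k l m : nat) :
    {fraction {poly C}} :=
  chebA C k * chebA C l * chebA C m / FracField.tofrac ('X - 1)
  * (3 - (chebA C k)^-1 - (chebA C l)^-1 - (chebA C m)^-1).

(* Main.v *)
Require Import Defs.
From mathcomp Require Import all_boot all_order all_algebra.
From mathcomp Require Import perm cyclic separable cyclotomic boolp ring zify.

Set Implicit Arguments.
Unset Strict Implicit.
Unset Printing Implicit Defensive.

Import GRing.Theory Num.Theory.

Local Open Scope ring_scope.

(* Matrix-tree theorem: the row of the Laplacian L at v is the sum, over the
   darts d leaving v, of e_v - e_(tgt d).  Expand the determinant of L, with the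
   row of a root r replaced by e_r, by multilinearity into a sum over the choices
   of one dart leaving each v <> r.  Such a choice contributes 1 if following it
   leads every vertex to r, and 0 otherwise, since the indicator of the vertices
   that never reach r is then in the kernel.  The choices leading to r are the
   spanning trees oriented towards r.

   Summing over all roots, 4n tau is the derivative at 0 of det(X + L).  The
   discrete Fourier transform block-diagonalizes X + L into 4 x 4 blocks, indexed
   by the n-th roots of unity zeta.  At zeta = 1 the block has determinant
   X (X + 1)^2 (X + 4), and at the others its value at X = 0 is (w - 1) Q(w) with
   w = (zeta + 1/zeta) / 2.  So n tau is the product of the |(w - 1) Q(w)| over
   zeta <> 1, which is evaluated in terms of the roots of Q with
   2 T_n(x) - 2 = prod_zeta 2 (x - w). *)

(** * Spanning trees as maps towards a root *)

Lemma uniq_map_inj (T U : eqType) (f : T -> U) (s : seq T) :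
  uniq (map f s) -> {in s &, injective f}.
Proof.
elim: s => // x s IHs /= /andP[fx us] y z; rewrite !inE.
case/predU1P=> [->|ys] /predU1P[->|zs] // E.
- by rewrite E map_f in fx.
- by rewrite -E map_f in fx.
exact: IHs.
Qed.

Section Multigraph.
Variable G : multigraph.
Implicit Types (d : dart G) (S T : {set edge G}).

Lemma same_edge_dart d d' :
  d.1 = d'.1 ->
  d = d' \/ (dart_src d = dart_tgt d' /\ dart_tgt d = dart_src d').
Proof.
by case: d d' => [e []] [e' []] /= ->; rewrite /dart_src /dart_tgt /=; auto.
Qed.

Lemma adjacentP S u v :
  reflect (exists2 d, d.1 \in S & dart_src d = u /\ dart_tgt d = v)
          (adjacent S u v).
Proof.
apply: (iffP existsP) =>
  [[e /andP[eS /orP[/eqP E|/eqP E]]]|[[e b] /= eS [<- <-]]].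
- by exists (e, false) => //; rewrite /dart_src /dart_tgt E.
- by exists (e, true) => //; rewrite /dart_src /dart_tgt E.
by exists e; rewrite eS /dart_src /dart_tgt; case: b; case: (ends e) => a c /=;
  rewrite eqxx ?orbT.
Qed.

Lemma adjacent_sym S : symmetric (adjacent S).
Proof.
by move=> u v; apply/existsP/existsP => -[e /andP[eS He]]; exists e;
  rewrite eS orbC.
Qed.

(** Lifts a simple vertex path to darts. In the last clause [d0] and [d1] may be one and the same
    closing dart, which turns the path into a cycle. *)
Lemma path_darts T b (p : seq (vertex G)) :
    path (adjacent T) b p -> uniq (b :: p) ->
  exists c : seq (dart G),
    [/\ [seq dart_src d | d <- c] = belast b p,
        {in c, forall d, [/\ d.1 \in T, dart_src d \in b :: p
                           & dart_tgt d \in b :: p]},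
        uniq [seq d.1 | d <- c]
      & forall d0 d1, dart_tgt d0 = b -> dart_src d1 = last b p ->
          path (fun d d' => dart_tgt d == dart_src d') d0 (rcons c d1)].
Proof.
elim: p b => [|v p IHp] b /=.
  move=> _ _; exists [::]; split=> //.
  by move=> d0 d1 Hb Hs; rewrite /= Hb Hs eqxx.
case/andP=> /adjacentP[d dT [src_d tgt_d]] vp /andP[b_vp uniq_vp].
have [c [src_c c_in uniq_c path_c]] := IHp v vp uniq_vp.
exists (d :: c); split.
- by rewrite /= src_d src_c.
- move=> d'; rewrite inE => /predU1P[->|/c_in[? ? ?]].
    by rewrite src_d tgt_d !inE !eqxx orbT.
  by split=> //; rewrite inE; apply/orP; right.
(* A later dart on the same edge would have [b] as an endpoint, but later endpoints lie in
   [v :: p]. *)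
- rewrite /= uniq_c andbT; apply/mapP=> -[d' /c_in[_ src' tgt']].
  case/same_edge_dart=> [E|[E _]]; first by rewrite -E src_d (negPf b_vp) in src'.
  by rewrite -E src_d (negPf b_vp) in tgt'.
by move=> d0 d1 tgt_d0 src_d1; rewrite /= tgt_d0 src_d eqxx path_c.
Qed.

(** A simple path in [T] from the head of [e] back to its tail is closed up by [e]; for a loop the
    path is empty. *)
Lemma cycle_setU1 T e :
  spans_connected T -> e \notin T -> exists c, is_cycle_in (e |: T) c.
Proof.
move=> connT eT; pose de : dart G := (e, false).
have /connectP[p0 p0_path] := connT (dart_tgt de) (dart_src de).
case/shortenP: p0_path => p p_path p_uniq _ last_p.
have [c [src_c c_in uniq_c path_c]] := path_darts p_path p_uniq.
exists (de :: c); split=> //.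
- exact: path_c.
- rewrite /= uniq_c andbT; apply: contra eT => /mapP[d /c_in[dT _ _] ->] //.
- by rewrite /= src_c last_p -rcons_uniq -lastI.
apply/allP=> d; rewrite inE => /predU1P[->|/c_in[dT _ _]]; first exact: setU11.
by rewrite in_setU1 dT orbT.
Qed.

Lemma is_cycle_inS S T c : S \subset T -> is_cycle_in S c -> is_cycle_in T c.
Proof.
move=> ST [c0 cyc ue us /allP cS]; split=> //.
by apply/allP=> d /cS /(subsetP ST).
Qed.

(* A map [f : V -> option dart] picks for each vertex other than the root [r]
   a dart leaving it; it is a rooted spanning tree when following the darts
   decreases some height. *)
Definition out_choice (r v : vertex G) (o : option (dart G)) : bool :=
  if o is Some d then (v != r) && (dart_src d == v) else v == r.

Definition descends (f : vertex G -> option (dart G)) (h : vertex G -> nat) :=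
  forall v d, f v = Some d -> (h (dart_tgt d) < h v)%N.

Definition chosen_edges (f : vertex G -> option (dart G)) : {set edge G} :=
  [set e | [exists v, if f v is Some d then d.1 == e else false]].

Lemma chosen_edgesP (f : vertex G -> option (dart G)) e :
  reflect (exists v d, f v = Some d /\ d.1 = e) (e \in chosen_edges f).
Proof.
rewrite inE; apply: (iffP existsP) => [[v]|[v [d [fv <-]]]]; last first.
  by exists v; rewrite fv.
by case fv: (f v) => [d|//] /eqP <-; exists v, d.
Qed.

Section Choice.
Variables (r : vertex G) (f : vertex G -> option (dart G)).
Variable h : vertex G -> nat.
Hypotheses (fP : forall v, out_choice r v (f v)) (hP : descends f h).

Lemma out_choiceSome v d : f v = Some d -> v != r /\ dart_src d = v.
Proof. by move=> fv; have := fP v; rewrite fv => /andP[-> /eqP]. Qed.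

Lemma out_choiceNone v : f v = None -> v = r.
Proof. by move=> fv; have := fP v; rewrite fv => /eqP. Qed.

Lemma chosen_edges_connected : spans_connected (chosen_edges f).
Proof.
have to_r v : connect (adjacent (chosen_edges f)) v r.
  have [k] := ubnP (h v); elim: k v => // k IHk v; rewrite ltnS => hv.
  case fv: (f v) => [d|]; last by rewrite (out_choiceNone fv) connect0.
  apply: connect_trans (IHk (dart_tgt d) _); last exact: leq_trans (hP fv) hv.
  apply/connect1/adjacentP; exists d; first by apply/chosen_edgesP; exists v, d.
  by have [_ ->] := out_choiceSome fv.
move=> u v; apply: connect_trans (to_r u) _.
by rewrite (sym_connect_sym (@adjacent_sym _)).
Qed.

(* At a highest vertex of a cycle both cycle edges would be the chosen one. *)
Lemma chosen_edges_acyclic : acyclic (chosen_edges f).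
Proof.
move=> c [c_neq0 c_cycle uniq_e _ /allP c_in].
have [d0 d0c] : exists d, d \in c.
  by case: c c_neq0 {c_cycle uniq_e c_in} => // d c _; exists d; rewrite mem_head.
case: (@arg_maxnP (dart G) d0 (mem c) (fun d => h (dart_src d)) d0c).
move=> d dc d_max.
have tgt_le d' : d' \in c -> (h (dart_tgt d') <= h (dart_src d))%N.
  move=> d'c; rewrite (eqP (next_cycle c_cycle d'c)).
  by have : next c d' \in c; [rewrite mem_next | apply: d_max].
have in_c d' : d' \in c -> exists v d1, [/\ f v = Some d1, dart_src d1 = v
    & d'.1 = d1.1 /\ (d' = d1 \/
        (dart_src d' = dart_tgt d1 /\ dart_tgt d' = dart_src d1))].
  move=> /c_in /chosen_edgesP[v [d1 [fv /esym Ed]]]; exists v, d1.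
  have [_ ?] := out_choiceSome fv; split=> //; split=> //.
  exact: same_edge_dart.
have fd : f (dart_src d) = Some d.
  have [v [d1 [fv src_d1 [_ [->|[srcd tgtd]]]]]] := in_c d dc.
    by rewrite src_d1.
  by have := hP fv; rewrite ltnNge -srcd -src_d1 -tgtd tgt_le.
(* The cycle enters the top vertex by [prev c d]. Descent forbids this dart to be a chosen one, so
   its reverse is the choice at the top, namely [d]. Both then use one edge, so they coincide, and a
   loop cannot descend. *)
have pc : prev c d \in c by rewrite mem_prev.
have tgt_p : dart_tgt (prev c d) = dart_src d := eqP (prev_cycle c_cycle dc).
have [v [d1 [fv src_d1 [Ee [E|[srcd tgtd]]]]]] := in_c _ pc.
  have := hP fv; rewrite -src_d1 -E tgt_p ltnNge.
  by rewrite [(_ <= _)%N](d_max _ pc).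
have Ed : d = d1.
  by move: fv; rewrite -src_d1 -tgtd tgt_p fd => -[].
have Ep : prev c d = d by apply: (uniq_map_inj uniq_e) => //=; rewrite Ee Ed.
by have := hP fd; rewrite -tgt_p Ep ltnn.
Qed.

End Choice.

(** Induction on height: if [g] used the edge of [f v] backwards, it would do so from a lower
    vertex, where [f] agrees with [g]; then [f] would descend along this edge in both directions. *)
Lemma chosen_edges_inj r f g hf hg :
  (forall v, out_choice r v (f v)) -> descends f hf ->
  (forall v, out_choice r v (g v)) -> descends g hg ->
  chosen_edges f = chosen_edges g -> f =1 g.
Proof.
move=> fP fh gP gh Efg v; have [k] := ubnP (hf v).
elim: k v => // k IHk v; rewrite ltnS => hv.
case fv: (f v) => [d|]; last first.
  case gv: (g v) => [d|] //; have [/eqP[]] := out_choiceSome gP gv.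
  exact: (out_choiceNone fP fv).
have /chosen_edgesP[u [d' [gu Ed]]] : d.1 \in chosen_edges g.
  by rewrite -Efg; apply/chosen_edgesP; exists v, d.
have [_ src_d] := out_choiceSome fP fv; have [_ src_d'] := out_choiceSome gP gu.
case: (same_edge_dart Ed) => [E|[E1 E2]].
  by rewrite -E -gu -src_d' E src_d.
have hu : (hf u < hf v)%N by rewrite -src_d' E1 fh.
have fu : f u = Some d' by rewrite IHk // (leq_trans hu).
by have := fh _ _ fu; rewrite E2 src_d ltnNge (ltnW hu).
Qed.

(** The height is the distance to [r] within [S], and [f] picks a dart of [S] to a closer vertex.
    The chosen edges already connect everything, so a further edge of [S] would close a cycle. *)
Lemma spanning_tree_chosen r S :
  spanning_tree S -> exists f : {ffun vertex G -> option (dart G)},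
    [/\ forall v, out_choice r v (f v), exists h, descends f h
      & S = chosen_edges f].
Proof.
move=> [connS acycS].
pose walk v k := `[< exists p, [/\ path (adjacent S) v p, last v p = r
                                 & size p = k] >].
have exw v : exists k, walk v k.
  have /connectP[p vp last_p] := connS v r; exists (size p).
  by apply/asboolP; exists p.
pose h v := ex_minn (exw v).
have step v : v != r -> exists d,
    [&& d.1 \in S, dart_src d == v & (h (dart_tgt d) < h v)%N].
  rewrite {2}/h; case: ex_minnP => k /asboolP[[|w p] /= [vp lastp <-] _].
    by rewrite lastp eqxx.
  case/andP: vp => /adjacentP[d dS [src_d tgt_d]] wp _; exists d.
  rewrite dS src_d tgt_d eqxx /= ltnS /h; case: ex_minnP => j _; apply.
  by apply/asboolP; exists p.
pose f := [ffun v => if v == r then None else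
  [pick d : dart G | [&& d.1 \in S, dart_src d == v
                       & (h (dart_tgt d) < h v)%N]]].
have fS v d : f v = Some d ->
    [/\ v != r, d.1 \in S, dart_src d = v & (h (dart_tgt d) < h v)%N].
  rewrite ffunE; case: eqVneq => // _.
  by case: pickP => // d' /and3P[? /eqP ? ?] [<-].
have fP v : out_choice r v (f v).
  case fv: (f v) => [d|] /=; first by have [-> _ -> _] := fS _ _ fv; apply: eqxx.
  move: fv; rewrite ffunE; case: eqVneq => // /step[d dP].
  by case: pickP => // /(_ d); rewrite dP.
have fh : descends f h by move=> v d /fS[].
exists f; split=> //; first by exists h.
have sub : chosen_edges f \subset S.
  by apply/subsetP=> e /chosen_edgesP[v [d [/fS[_ ? _ _] <-]]].
apply/eqP; rewrite eqEsubset sub andbT; apply/subsetP=> e eS.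
apply/contraT => /(cycle_setU1 (chosen_edges_connected fP fh))[c c_cyc].
by case: (acycS c); apply: is_cycle_inS c_cyc; rewrite subUset sub1set eS.
Qed.

End Multigraph.

(** * The matrix-tree theorem *)

(** Multilinearity in all rows at once: each product of the Leibniz formula is distributed over the
    row sums. *)
Lemma det_sum_rows (R : comNzRingType) N (J : finType) (Q : 'I_N -> pred J)
    (F : 'I_N -> J -> 'I_N -> R) :
  \det (\matrix_(i, j) \sum_(x | Q i x) F i x j) =
  \sum_(f in family Q) \det (\matrix_(i, j) F i (f i) j).
Proof.
rewrite /determinant exchange_big /=; apply: eq_bigr => s _.
rewrite -big_distrr /=; congr (_ * _).
under eq_bigr do rewrite mxE.
rewrite bigA_distr_big_dep; apply: eq_bigr => f _.
by apply: eq_bigr => i _; rewrite mxE.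
Qed.

Section PartialMap.
Variables (F : fieldType) (N : nat) (nx : 'I_N -> option 'I_N).

Let M : 'M[F]_N := \matrix_(i, j) ((j == i)%:R - (nx i == Some j)%:R).

(* A permutation contributing to the determinant moves each non-fixed point
   [i] to [nx i], hence decreases the height along its nontrivial cycles. *)
Lemma det_descending (h : 'I_N -> nat) :
  (forall i j, nx i = Some j -> (h j < h i)%N) -> \det M = 1.
Proof.
move=> hP; rewrite /determinant (bigD1 (1%g : 'S_N)) //= odd_perm1 mul1r.
rewrite big1 => [|i _]; last first.
  rewrite mxE perm1 eqxx; case: eqP => [/hP|_]; last by rewrite subr0.
  by rewrite ltnn.
rewrite big1 ?addr0 // => s s_neq1.
have [i0 i0P] : exists i, s i != i.
  apply/existsP; apply: contraNT s_neq1 => /existsPn s1; apply/eqP/permP=> i.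
  by rewrite perm1; apply/eqP; have := s1 i; rewrite negbK.
case: (@arg_minnP _ i0 (fun i => s i != i) h i0P) => i si i_min.
have [nx_i|nx_i] := eqVneq (nx i) (Some (s i)).
  have := i_min (s i); rewrite (inj_eq perm_inj) leqNgt (hP _ _ nx_i).
  by move=> /(_ si).
by rewrite (bigD1 i) //= mxE (negPf si) (negPf nx_i) subrr mul0r mulr0.
Qed.

Lemma det_nondescending :
  ~ (exists h : 'I_N -> nat, forall i j, nx i = Some j -> (h j < h i)%N) ->
  \det M = 0.
Proof.
move=> noh.
(* [stops i k]: the orbit of [i] has reached [None] after [k] steps. A [live] index has an infinite
   orbit. *)
pose stops i k := iter k (obind nx) (Some i) == None.
pose live i := `[< forall k, ~~ stops i k >].
have stopsS i k : stops i k.+1 = if nx i is Some j then stops j k else true.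
  rewrite /stops iterSr /=; case: (nx i) => //=.
  by elim: k => //= k /eqP->.
have live_nx i : live i = if nx i is Some j then live j else false.
  case nx_i: (nx i) => [j|].
    apply/asboolP/asboolP=> [Hi k|Hj [|k]] //.
      by have := Hi k.+1; rewrite stopsS nx_i.
    by rewrite stopsS nx_i.
  by apply/asboolP=> /(_ 1); rewrite stopsS nx_i.
(* If every orbit stopped, the least stopping time would be a height. *)
have [i0 live_i0] : exists i, live i.
  apply: contrapT => dead; apply: noh.
  have ex i : exists k, stops i k.
    apply: contrapT => H; apply: dead; exists i; apply/asboolP=> k.
    by apply/negP=> ik; apply: H; exists k.
  exists (fun i => ex_minn (ex i)) => i j nx_i.
  case: (ex_minnP (ex i)) => -[|k]; first by rewrite /stops.
  rewrite stopsS nx_i => jk _.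
  by case: ex_minnP => k' _ /(_ _ jk).
(* [det0P] yields row vectors in the left kernel, hence the transpose. *)
rewrite -det_tr; apply/eqP/det0P; exists (\row_i (live i)%:R).
  by apply/eqP=> /rowP/(_ i0)/eqP; rewrite !mxE live_i0 oner_eq0.
apply/rowP=> i; rewrite !mxE.
under eq_bigr do rewrite !mxE mulrBr.
rewrite sumrB (bigD1 i) //= eqxx mulr1 big1 ?addr0 => [|j /negPf->];
  last by rewrite mulr0.
rewrite live_nx; case: (nx i) => [j|].
  rewrite (bigD1 j) //= eqxx mulr1 big1 ?addr0 ?subrr // => j' j'j.
  by rewrite (inj_eq Some_inj) eq_sym (negPf j'j) mulr0.
by rewrite big1 ?subr0 // => j _; rewrite mulr0.
Qed.

End PartialMap.

Section MatrixTree.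
Variables (F : fieldType) (G : multigraph) (N : nat).
Variables (e : 'I_N -> vertex G) (e' : vertex G -> 'I_N).
Hypotheses (eK : cancel e e') (e'K : cancel e' e).

(** Written as a sum of one row per dart, ready for [det_sum_rows]; both darts of a loop contribute
    zero. *)
Definition laplacian : 'M[F]_N :=
  \matrix_(i, j) \sum_(d : dart G | dart_src d == e i)
     ((j == i)%:R - (e j == dart_tgt d)%:R).

(** Row [r] is replaced rather than deleted, because this is the matrix that [deriv_det]
    produces. *)
Theorem matrix_tree (r : 'I_N) :
  \det (\matrix_(i, j) if i == r then (j == i)%:R else laplacian i j) =
  (num_spanning_trees G)%:R.
Proof.
pose nx (f : {ffun 'I_N -> option (dart G)}) i := omap (e' \o @dart_tgt G) (f i).
pose ok (f : {ffun 'I_N -> option (dart G)}) :=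
  `[< exists h : 'I_N -> nat, forall i j, nx f i = Some j -> (h j < h i)%N >].
pose Q i := out_choice (e r) (e i).
transitivity (\sum_(f in family Q) \det
   (\matrix_(i, j) (((j == i)%:R - (nx f i == Some j)%:R) : F))).
  (* At the root the only admissible choice is [None], whose row is the unit row; elsewhere the
     choices are the outgoing darts. *)
  have -> : \det (\matrix_(i, j) if i == r then (j == i)%:R else laplacian i j)
    = \det (\matrix_(i, j) \sum_(o | Q i o)
       ((j == i)%:R - (omap (e' \o @dart_tgt G) o == Some j)%:R) : 'M[F]_N).
    congr (\det _); apply/matrixP=> i j; rewrite !mxE /Q.
    case: (eqVneq i r) => [->|ir].
      rewrite (big_pred1 None) ?subr0 // => -[d|] /=; last by rewrite !eqxx.
      by rewrite eqxx.
    rewrite [RHS](bigID isSome) /= [X in _ + X]big1 ?addr0; last first.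
      by case=> [d|] /andP[] //=; rewrite (inj_eq (can_inj eK)) (negPf ir).
    rewrite (reindex_omap Some id) //=; last by case=> [d|] // /andP[].
    apply: eq_big => [d|d _].
      by rewrite (inj_eq (can_inj eK)) ir eqxx !andbT.
    by rewrite (inj_eq Some_inj) (can2_eq e'K eK) [dart_tgt d == _]eq_sym.
  by rewrite det_sum_rows.
(* The descending choices, in bijection with the spanning trees through [edges_of]. *)
pose A := [set f | (f \in family Q) && ok f].
pose edges_of (f : {ffun 'I_N -> option (dart G)}) := chosen_edges (f \o e').
have AP f : f \in A ->
    (forall v, out_choice (e r) v ((f \o e') v)) /\
    exists h, descends (f \o e') h.
  rewrite inE => /andP[/familyP fQ /asboolP[h hP]]; split=> [v|].
    by have := fQ (e' v); rewrite /Q unfold_in e'K.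
  exists (h \o e') => v d /= fv; apply: hP.
  by rewrite /nx fv /=.
have -> : num_spanning_trees G = #|A|.
  rewrite /num_spanning_trees -(@card_in_imset _ _ edges_of A); last first.
    move=> f g /AP[fQ [hf fh]] /AP[gQ [hg gh]] /(chosen_edges_inj fQ fh gQ gh) fg.
    by apply/ffunP=> i; have := fg (e i); rewrite /= eK.
  congr #|pred_of_set _|; apply/setP=> S; rewrite inE.
  apply/asboolP/imsetP=> [/(spanning_tree_chosen (e r))|].
    case=> f [fP [h fh] ->]; exists [ffun i => f (e i)].
      rewrite inE; apply/andP; split.
        by apply/familyP=> i; rewrite unfold_in ffunE; apply: fP.
      apply/asboolP; exists (h \o e) => i j; rewrite /nx ffunE /=.
      by case fi: (f (e i)) => [d|] //= [<-]; rewrite e'K fh.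
    by apply/setP=> x; apply/chosen_edgesP/chosen_edgesP => -[v [d [H <-]]];
      exists v, d; move: H; rewrite /= ffunE e'K.
  case=> f /AP[fP [h fh]] ->; split.
    exact: chosen_edges_connected fP fh.
  exact: chosen_edges_acyclic fP fh.
rewrite -sum1_card natr_sum [RHS](eq_bigl (fun f => (f \in family Q) && ok f)) =>
  [|f]; last by rewrite inE.
rewrite big_mkcondr /=; apply: eq_bigr => f _.
rewrite /ok; case: asboolP => [[h hP]|noh]; first exact: det_descending hP.
exact: det_nondescending.
Qed.

End MatrixTree.

(** * Determinants *)

Lemma deriv_prod (R : comNzRingType) N (F : 'I_N -> {poly R}) :
  (\prod_i F i)^`() = \sum_r \prod_i (if i == r then (F i)^`() else F i).
Proof.
elim: N F => [|N IHN] F; first by rewrite !big_ord0 derivC.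
rewrite !big_ord_recl derivM IHN /=; congr (_ + _).
rewrite big_distrr /=; apply: eq_bigr => r _.
rewrite big_ord_recl /=; congr (_ * _).
Qed.

Lemma deriv_det (R : comNzRingType) N (A : 'M[{poly R}]_N) :
  (\det A)^`() =
  \sum_r \det (\matrix_(i, j) if i == r then (A i j)^`() else A i j).
Proof.
rewrite /determinant (raddf_sum (@deriv R)) exchange_big /=.
apply: eq_bigr => s _.
have -> p : ((-1) ^+ s * p)^`() = (-1) ^+ s * p^`() :> {poly R}.
  by rewrite !mulr_sign; case: ifP => _; rewrite ?derivN.
rewrite deriv_prod.
rewrite -big_distrr /=.
by congr (_ * _); apply: eq_bigr => r _; apply: eq_bigr => i _; rewrite mxE.
Qed.

Lemma det_castmx (R : comNzRingType) m n (e : m = n) (e' : m = n) (A : 'M[R]_m) :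
  \det (castmx (e, e') A) = \det A.
Proof. by case: _ / e in e' *; rewrite castmx_id. Qed.

Lemma det_mxdiag (R : comNzRingType) n (p : 'I_n -> nat)
    (B : forall i, 'M[R]_(p i)) :
  \det (\mxdiag_i B i) = \prod_i \det (B i).
Proof.
elim: n p B => [|n IHn] p B.
  rewrite [RHS]big_ord0; move: (\mxdiag_i B i).
  have : (\sum_i p i = 0)%N by rewrite big_ord0.
  by case: (\sum_i p i)%N => // _ A; apply: det_mx00.
by rewrite mxdiag_recl det_castmx det_ublock IHn big_ord_recl.
Qed.

(** * Tree count from the derivative of the characteristic polynomial *)

Section Charpoly.
Variables (F : fieldType) (G : multigraph) (N : nat).
Variables (e : 'I_N -> vertex G) (e' : vertex G -> 'I_N).
Hypotheses (eK : cancel e e') (e'K : cancel e' e).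

(** The characteristic polynomial of [- A] is [\det (xmx A)]; the plus sign avoids signs in the
    derivative at 0. *)
Definition xmx (R : comNzRingType) m (A : 'M[R]_m) : 'M[{poly R}]_m :=
  'X%:M + map_mx polyC A.

Lemma deriv_det_laplacian :
  (\det (xmx (laplacian F e)))^`().[0] = N%:R * (num_spanning_trees G)%:R.
Proof.
rewrite deriv_det -horner_evalE rmorph_sum /=.
rewrite (eq_bigr (fun=> (num_spanning_trees G)%:R)) => [|r _].
  by rewrite sumr_const card_ord [RHS]mulr_natl.
rewrite -(matrix_tree F eK e'K r) -det_map_mx; congr (\det _).
apply/matrixP=> i j; rewrite !mxE.
case: eqP => _.
  by rewrite derivD derivC derivMn derivX addr0 rmorph_nat eq_sym.
by rewrite rmorphD rmorphMn /= /horner_eval hornerX hornerC mul0rn add0r.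
Qed.

End Charpoly.

(** A weighted Laplacian of the star with three leaves: the shape of every Fourier block. *)
Definition star_mx (R : comNzRingType) (c : R) (a : 'I_3 -> R) : 'M[R]_4 :=
  \matrix_(x, x')
    match unlift ord0 x, unlift ord0 x' with
    | None, None => c
    | Some i, Some i' => a i *+ (i == i')
    | _, _ => -1
    end.

Lemma det_star_mx (R : comNzRingType) (c : R) (a : 'I_3 -> R) :
  let a0 := a ord0 in let a1 := a (lift ord0 ord0) in
  let a2 := a (lift ord0 (lift ord0 ord0)) in
  \det (star_mx c a) = c * (a0 * a1 * a2) - (a1 * a2 + a0 * a2 + a0 * a1).
Proof.
move=> a0 a1 a2.
(* Entries indexed by [nat] compute during the cofactor expansion. *)
pose g (i j : nat) : R :=
  match i, j with
  | 0, 0 => c | 1, 1 => a0 | 2, 2 => a1 | 3, 3 => a2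
  | 0, _ => -1 | _, 0 => -1 | _, _ => 0
  end.
have -> : star_mx c a = \matrix_(i, j) g i j.
  apply/matrixP=> x x'; rewrite !mxE.
  by case: (unliftP ord0 x) => [[[|[|[|]]] // p]|] ->;
    case: (unliftP ord0 x') => [[[|[|[|]]] // p']|] -> //=;
    congr (a _); apply: val_inj.
rewrite (expand_det_row _ ord_max) !big_ord_recl !big_ord0 !mxE /=.
rewrite !(mul0r, add0r, addr0) /cofactor.
rewrite !(@expand_det_row R 3 _ ord_max) !big_ord_recl !big_ord0 !mxE /=.
rewrite !(mul0r, add0r, addr0) /cofactor.
rewrite !(@expand_det_row R 2 _ ord_max) !big_ord_recl !big_ord0 !mxE /=.
rewrite !(mul0r, add0r, addr0) /cofactor !det_mx11 !mxE /=.
ring.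
Qed.

Lemma xmx_star (R : comNzRingType) (c : R) (a : 'I_3 -> R) :
  xmx (star_mx c a) = star_mx ('X + c%:P) (fun i => 'X + (a i)%:P).
Proof.
apply/matrixP=> x x'; rewrite !mxE.
case: (unliftP ord0 x) => [i|] ->; case: (unliftP ord0 x') => [i'|] -> /=.
- by rewrite (inj_eq lift_inj) polyCMn mulrnDl.
- by rewrite add0r polyCN.
- by rewrite add0r polyCN.
by [].
Qed.

(** * Fourier transform of the Laplacian of the Y-graph *)

Lemma sum_darts (R : nmodType) (G : multigraph) (v : vertex G)
    (phi : vertex G -> R) :
  \sum_(d : dart G | dart_src d == v) phi (dart_tgt d) =
  \sum_(e : edge G) ((if (ends e).1 == v then phi (ends e).2 else 0) +
                     (if (ends e).2 == v then phi (ends e).1 else 0)).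
Proof.
rewrite big_mkcond -(pair_bigA _ (fun (e : edge G) b =>
  if dart_src (e, b) == v then phi (dart_tgt (e, b)) else 0)) /=.
by apply: eq_bigr => e _; rewrite big_bool addrC.
Qed.

Section YNeighbours.
Variables (R : nmodType) (n k l m : nat).
Let Y := Ygraph n k l m.
Variable phi : vertex Y -> R.

(** The backward shift by [j] is a forward shift by [j * n.-1], which is congruent to [- j] modulo
    [n]. *)
Lemma shift_modK j : cancel (fun y : 'I_n => shift_mod y j)
                            (fun y => shift_mod y (j * n.-1)).
Proof.
case: n => [|n'] y; first by case: y.
apply: val_inj; rewrite /= modnDml -addnA -mulnS addnC modnMDl.
by rewrite modn_small.
Qed.

Lemma shift_modVK j : cancel (fun y : 'I_n => shift_mod y (j * n.-1))
                             (fun y => shift_mod y j).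
Proof.
case: n => [|n'] y; first by case: y.
apply: val_inj; rewrite /= modnDml -addnA addnC [(_ + j)%N]addnC -mulnS modnMDl.
by rewrite modn_small.
Qed.

Lemma sum_if_eq (I : finType) (a : I) (f : I -> R) :
  \sum_i (if i == a then f i else 0) = f a.
Proof. by rewrite -big_mkcond big_pred1_eq. Qed.

Lemma Ysum_centre (y : 'I_n) :
  \sum_(d : dart Y | dart_src d == (ord0, y)) phi (dart_tgt d) =
  \sum_(i < 3) phi (lift ord0 i, y).
Proof.
rewrite sum_darts /= big_sumType /= big1 => [|[i y'] _] /=; last first.
  by rewrite ?xpair_eqE /= addr0.
rewrite add0r.
transitivity (\sum_(i < 3) \sum_y'
    (if y' == y then phi (lift ord0 i, y') else 0)).
  rewrite pair_bigA; apply: eq_bigr => -[i y'] _ /=.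
  by rewrite ?xpair_eqE /= add0r.
by apply: eq_bigr => i _; apply: sum_if_eq.
Qed.

Lemma Ysum_leaf i (y : 'I_n) :
  \sum_(d : dart Y | dart_src d == (lift ord0 i, y)) phi (dart_tgt d) =
  phi (lift ord0 i, shift_mod y (Yjump k l m i)) +
  phi (lift ord0 i, shift_mod y (Yjump k l m i * n.-1)) + phi (ord0, y).
Proof.
have pick (f : 'I_3 -> 'I_n -> R) y0 :
    \sum_(p : 'I_3 * 'I_n) (if (p.1 == i) && (p.2 == y0) then f p.1 p.2 else 0)
    = f i y0.
  rewrite -(pair_bigA _ (fun i' y' =>
    if (i' == i) && (y' == y0) then f i' y' else 0)).
  rewrite (bigD1 i) //= [X in _ + X]big1 ?addr0 => [|i' /negPf i'i].
    by rewrite eqxx sum_if_eq.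
  by rewrite i'i big1.
rewrite sum_darts /= big_sumType /=; congr (_ + _).
  rewrite big_split /=; congr (_ + _).
    rewrite -(pick (fun i y => phi (lift ord0 i, shift_mod y (Yjump k l m i)))).
    by apply: eq_bigr => -[i' y'] _; rewrite /= ?xpair_eqE (inj_eq lift_inj).
  rewrite -(pick (fun i y => phi (lift ord0 i, y))).
  apply: eq_bigr => -[i' y'] _; rewrite /= ?xpair_eqE (inj_eq lift_inj).
  case: eqP => //= ->; congr (if _ then _ else _).
  by rewrite (can2_eq (shift_modK _) (shift_modVK _)).
rewrite -(pick (fun i y => phi (ord0, y))).
by apply: eq_bigr => -[i' y'] _; rewrite /= ?xpair_eqE /= addr0 (inj_eq lift_inj).
Qed.

End YNeighbours.

Lemma mul_laplacian_mx (F : fieldType) (G : multigraph) (N p : nat)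
    (e : 'I_N -> vertex G) (e' : vertex G -> 'I_N) (M : 'M[F]_(N, p)) s t :
  cancel e e' -> cancel e' e ->
  (laplacian F e *m M) s t =
  \sum_(d : dart G | dart_src d == e s) (M s t - M (e' (dart_tgt d)) t).
Proof.
move=> eK e'K; rewrite mxE; under eq_bigr do rewrite mxE big_distrl /=.
rewrite exchange_big /=; apply: eq_bigr => d _.
under eq_bigr do rewrite mulrBl.
rewrite sumrB (bigD1 s) //= eqxx mul1r big1 => [|u /negPf->];
  last by rewrite mul0r.
rewrite (bigD1 (e' (dart_tgt d))) //= e'K eqxx mul1r big1 ?addr0 // => u.
by rewrite -(inj_eq (can_inj e'K)) eK => /negPf->; rewrite mul0r.
Qed.

(** Orthogonality of characters: a geometric sum whose ratio [u] satisfies [u ^+ n = 1], with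
    [u = 1] only if [i = j]. *)
Lemma sum_prim_root (F : fieldType) n (z : F) (i j : 'I_n) :
  n.-primitive_root z ->
  \sum_(y < n) z ^- (i * y) * z ^+ (j * y) = n%:R *+ (i == j).
Proof.
move=> zP; have z_neq0 : z != 0.
  by rewrite (prim_root_eq0 zP) -lt0n (prim_order_gt0 zP).
pose u := z ^- i * z ^+ j.
under eq_bigr => y _ do rewrite !exprM -exprVn -exprMn.
have [ij|ij] := eqVneq i j.
  under eq_bigr do rewrite ij mulVf ?expf_neq0 // expr1n.
  by rewrite sumr_const card_ord.
have u1 : u - 1 != 0.
  rewrite subr_eq0 -(inj_eq (mulfI (expf_neq0 i z_neq0))) mulVKf ?expf_neq0 //.
  by rewrite mulr1 (eq_prim_root_expr zP) !modn_small // eq_sym.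
apply: (mulfI u1); rewrite -subrX1 mulr0n mulr0.
by rewrite exprMn exprVn -!exprM ![(_ * n)%N]mulnC !exprM (prim_expr_order zP)
  !expr1n invr1 mul1r subrr.
Qed.

Lemma xmxE (R : comNzRingType) N (A : 'M[R]_N) i j :
  xmx A i j = 'X *+ (i == j) + (A i j)%:P.
Proof. by rewrite !mxE. Qed.

Section Fourier.
Variables (F : fieldType) (n k l m : nat).
Let Y := Ygraph n k l m.
Let N := (\sum_(j < n) 4)%N.

(* Enumerating the vertices frequency by frequency turns the matrices that are
   diagonal in the second coordinate into block diagonal ones. *)
Definition Yidx (s : 'I_N) : vertex Y :=
  let p := tagnat.sig s in (tagged p, tag p).
Definition Yrank (v : vertex Y) : 'I_N :=
  @tagnat.rank n (fun=> 4%N) (existT (fun=> 'I_4) v.2 v.1).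

Lemma YidxK : cancel Yidx Yrank.
Proof.
move=> s; rewrite /Yidx /Yrank /= -[RHS]tagnat.sigK.
by case: (tagnat.sig s).
Qed.

Lemma YrankK : cancel Yrank Yidx.
Proof. by move=> [x y]; rewrite /Yidx /Yrank tagnat.rankK. Qed.

Lemma Yidx_eq s t :
  (s == t) = ((Yidx s).2 == (Yidx t).2) && ((Yidx s).1 == (Yidx t).1).
Proof. by rewrite -(inj_eq (can_inj YidxK)) andbC. Qed.

Lemma mxdiagE (R : nmodType) (B : 'I_n -> 'M[R]_4) s t :
  (\mxdiag_(j < n) B j) s t =
  B (Yidx t).2 (Yidx s).1 (Yidx t).1 *+ ((Yidx s).2 == (Yidx t).2).
Proof.
rewrite mxE /Yidx /tagnat.sig1 /tagnat.sig2.
case: (tagnat.sig s) (tagnat.sig t) => [y x] [y' x'] /=.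
by case: eqP => [<-|_]; rewrite ?mxE // conform_mx_id.
Qed.

(** Degree 3 minus the phases of the two jump neighbours; this is 3 - 2 T_j(w) at w = (z + 1/z) / 2,
    with j the jump. *)
Definition Yweight (z : F) (i : 'I_3) : F :=
  3 - z ^+ Yjump k l m i - z ^- Yjump k l m i.

(** Since [z ^+ n = 1], a shift modulo [n] multiplies the wave by a power of [z], so only the layer
    index is mixed. *)
Lemma laplacian_wave (z : F) (v : vertex Y) (x : 'I_4) :
  z ^+ n = 1 -> 
  \sum_(d : dart Y | dart_src d == v)
    (z ^+ v.2 *+ (v.1 == x) - z ^+ (dart_tgt d).2 *+ ((dart_tgt d).1 == x)) =
  z ^+ v.2 * star_mx 3 (Yweight z) v.1 x.
Proof.
move=> zn1; case: v => x0 y.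
have n_gt0 : (0 < n)%N by case: (n) y => // -[].
have z_neq0 : z != 0.
  by apply: contra_eq_neq zn1 => ->; rewrite expr0n eqn0Ngt n_gt0 eq_sym oner_eq0.
have zV j : z ^+ (j * n.-1) = z ^- j.
  apply: (mulfI (expf_neq0 j z_neq0)); rewrite -exprD -mulnS prednK //.
  by rewrite mulfV ?expf_neq0 // mulnC exprM zn1 expr1n.
rewrite mxE /=.
case: (unliftP ord0 x0) => [i|] ->.
  rewrite (@Ysum_leaf _ n k l m (fun u =>
    z ^+ y *+ (lift ord0 i == x) - z ^+ u.2 *+ (u.1 == x))) /=.
  rewrite !expr_mod // !exprD zV /Yweight.
  case: (unliftP ord0 x) => [i'|] -> /=; rewrite ?(inj_eq lift_inj).
    case: (i == i'); rewrite ?mulr1n ?mulr0n; ring.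
  rewrite ?mulr1n ?mulr0n; ring.
rewrite (@Ysum_centre _ n k l m (fun u =>
  z ^+ y *+ (ord0 == x) - z ^+ u.2 *+ (u.1 == x))) /=.
case: (unliftP ord0 x) => [i'|] -> /=.
  rewrite (bigD1 i') //= eqxx big1 ?addr0 => [|i /negPf i'i].
    by rewrite mulr1n mulr0n; ring.
  by rewrite (inj_eq lift_inj) i'i subrr.
rewrite !big_ord_recl big_ord0 /= mulr1n mulr0n; ring.
Qed.

Lemma sum_Yidx (R : nmodType) (f : 'I_4 -> 'I_n -> R) :
  \sum_(s : 'I_N) f (Yidx s).1 (Yidx s).2 = \sum_x \sum_y f x y.
Proof.
rewrite pair_bigA /= (reindex Yidx) //.
by exists Yrank => v _; [apply: YidxK | apply: YrankK].
Qed.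

(** The Fourier matrix [W] intertwines the Laplacian with the block diagonal [D], and its nonzero
    determinant cancels. *)
Lemma det_xmx_laplacian z : n.-primitive_root z ->
  \det (xmx (laplacian F Yidx)) =
  \prod_(j < n) \det (xmx (star_mx 3 (Yweight (z ^+ j)))).
Proof.
move=> zP.
pose W : 'M[F]_N := \matrix_(s, t)
  (z ^+ (Yidx t).2 ^+ (Yidx s).2 *+ ((Yidx s).1 == (Yidx t).1)).
pose W' : 'M[F]_N := \matrix_(s, t)
  (z ^- ((Yidx s).2 * (Yidx t).2) *+ ((Yidx s).1 == (Yidx t).1)).
pose D : 'M[F]_N := \mxdiag_(j < n) star_mx 3 (Yweight (z ^+ j)).
have LW : laplacian F Yidx *m W = W *m D.
  apply/matrixP=> s t; rewrite (mul_laplacian_mx _ _ _ YidxK YrankK).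
  under eq_bigr do rewrite !mxE YrankK.
  have zn j : (z ^+ j) ^+ n = 1.
    by rewrite -exprM mulnC exprM (prim_expr_order zP) expr1n.
  rewrite laplacian_wave // !mxE.
  under eq_bigr do rewrite mxdiagE mxE.
  rewrite (sum_Yidx (fun x y => z ^+ y ^+ (Yidx s).2 *+ ((Yidx s).1 == x) *
    (star_mx 3 (Yweight (z ^+ (Yidx t).2)) x (Yidx t).1 *+ (y == (Yidx t).2)))).
  rewrite (bigD1 (Yidx s).1) //= [X in _ + X]big1 ?addr0 => [|x /negPf xs];
    last first.
    by rewrite big1 // => y _; rewrite eq_sym xs mulr0n mul0r.
  rewrite (bigD1 (Yidx t).2) //= [X in _ + X]big1 ?addr0 => [|y /negPf yt];
    last first.
    by rewrite yt mulr0n mulr0.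
  by rewrite !eqxx !mulr1n mxE.
have WW : W' *m W = n%:R%:M.
  apply/matrixP=> s t; rewrite !mxE.
  under eq_bigr do rewrite !mxE.
  rewrite (sum_Yidx (fun x y => z ^- ((Yidx s).2 * y) *+ ((Yidx s).1 == x) *
     (z ^+ (Yidx t).2 ^+ y *+ (x == (Yidx t).1)))).
  rewrite (bigD1 (Yidx s).1) //= [X in _ + X]big1 ?addr0 => [|x /negPf xs];
    last first.
    by rewrite big1 // => y _; rewrite eq_sym xs mulr0n mul0r.
  rewrite Yidx_eq; case: ((Yidx s).1 == (Yidx t).1); last first.
    by rewrite andbF big1 // => y _; rewrite mulr0n mulr0.
  rewrite andbT -(sum_prim_root _ _ zP).
  by apply: eq_bigr => y _; rewrite eqxx !mulr1n -exprM.
(* A primitive [n]-th root of unity forces [n] to be nonzero in [F]. *)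
have detW : \det W != 0.
  have /eqP := congr1 (fun M => \det M) WW; rewrite det_mulmx det_scalar.
  apply: contraTneq => ->; rewrite mulr0 eq_sym expf_neq0 //.
  exact: prim_root_natf_neq0 zP.
have detWP : \det (map_mx polyC W) != 0.
  by rewrite (det_map_mx (polyC : {rmorphism F -> {poly F}})) polyC_eq0.
have eqX : xmx (laplacian F Yidx) *m map_mx polyC W = map_mx polyC W *m xmx D.
  rewrite /xmx mulmxDl mulmxDr scalar_mxC.
  by rewrite -!(map_mxM (polyC : {rmorphism F -> {poly F}})) LW.
apply: (mulIf detWP); rewrite -det_mulmx eqX det_mulmx mulrC; congr (_ * _).
transitivity (\det (\mxdiag_(j < n) xmx (star_mx 3 (Yweight (z ^+ j)))));
  last by rewrite det_mxdiag.
congr (\det _); apply/matrixP=> s t.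
rewrite [RHS](mxdiagE (fun j : 'I_n => xmx (star_mx 3 (Yweight (z ^+ j))))).
rewrite !xmxE mxdiagE Yidx_eq.
by case: (_.2 == _.2); rewrite ?mulr1n // !mulr0n polyC0 addr0.
Qed.

End Fourier.

Lemma Y_tree_count (F : fieldType) (n k l m : nat) (z : F) :
  n.+1.-primitive_root z ->
  (4 * n.+1 * num_spanning_trees (Ygraph n.+1 k l m))%:R =
  4 * \prod_(i < n) \det (star_mx 3 (Yweight k l m (z ^+ i.+1))).
Proof.
move=> zP.
have := deriv_det_laplacian F (@YidxK n.+1 k l m) (@YrankK n.+1 k l m).
rewrite (det_xmx_laplacian k l m zP) big_ord_recl.
(* At frequency 0 all weights are 1: the star Laplacian has eigenvalues 0, 1, 1, 4. *)
have -> : \det (xmx (star_mx 3 (Yweight k l m (z ^+ (ord0 : 'I_n.+1))))) =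
    'X * (('X + 1) ^+ 2 * ('X + 4%:P)) :> {poly F}.
  rewrite xmx_star det_star_mx /Yweight expr0 !expr1n invr1.
  have -> : 3 - 1 - 1 = 1 :> F by ring.
  by rewrite !polyC_natr polyC1; ring.
(* The factor ['X] kills every other term of the product rule at 0. *)
have deriv0 (p q : {poly F}) : ('X * p * q)^`().[0] = p.[0] * q.[0].
  rewrite -mulrA derivM derivX hornerD !hornerM hornerX hornerC.
  by rewrite mul0r addr0 mul1r.
rewrite deriv0 horner_prod => H.
rewrite natrM.
have -> : (4 * n.+1 = \sum_(j < n.+1) 4)%N.
  by rewrite sum_nat_const card_ord mulnC.
rewrite -H; congr (_ * _).
  by rewrite !hornerE expr1n mul1r.
apply: eq_bigr => i _; rewrite -horner_evalE -det_map_mx; congr (\det _).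
by apply/matrixP=> s t; rewrite mxE xmxE rmorphD rmorphMn /= /horner_eval hornerX
  hornerC mul0rn add0r.
Qed.

(** * Chebyshev polynomials and the polynomial Q *)

(** In characteristic 0 the polynomial ['X^n - 1] is separable, hence has [n] distinct roots, one of
    them primitive. *)
Lemma prim_root_exists (C : numClosedFieldType) n :
  (0 < n)%N -> exists z : C, n.-primitive_root z.
Proof.
move=> n_gt0; have [r Dr] := closed_field_poly_normal ('X^n - 1 : {poly C}).
have {}Dr : 'X^n - 1 = \prod_(z <- r) ('X - z%:P).
  by rewrite {1}Dr (monicP (monicXnsubC 1 n_gt0)) scale1r.
have r_roots : all n.-unity_root r.
  by apply/allP=> z; rewrite -root_prod_XsubC -Dr.
have r_uniq : uniq r.
  by rewrite -separable_prod_XsubC -Dr separable_Xn_sub_1 // pnatr_eq0 -lt0n.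
have r_size : size r = n.
  by apply: succn_inj; rewrite -(size_prod_XsubC r id) -Dr size_XnsubC.
have /hasP[z _ zP] := has_prim_root n_gt0 r_roots r_uniq (eq_leq (esym r_size)).
by exists z.
Qed.

Lemma star_det_fieldE (F : fieldType) (a b d : F) :
  a != 0 -> b != 0 -> d != 0 ->
  3 * (a * b * d) - (b * d + a * d + a * b) =
  a * b * d * (3 - a^-1 - b^-1 - d^-1).
Proof. by move=> a0 b0 d0; field; rewrite a0 b0 d0. Qed.

(* Unlike [hornerE], leaves no monoid-law operators that [ring] cannot read. *)
Local Notation hornerR :=
  (hornerD, hornerN, hornerZ, hornerM, hornerX, hornerC).

Section Chebyshev.
Variable C : numClosedFieldType.
Implicit Types (z w : C) (j : nat).

Lemma chebTS R j : chebT R j.+2 = 2 *: ('X * chebT R j.+1) - chebT R j.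
Proof. by []. Qed.

Lemma nat_ind2 (P : nat -> Prop) :
  P 0 -> P 1 -> (forall j, P j -> P j.+1 -> P j.+2) -> forall j, P j.
Proof.
move=> P0 P1 PS j; suff: P j /\ P j.+1 by case.
by elim: j => // j [IH0 IH1]; split=> //; apply: PS.
Qed.

(** The identity T_j(cos phi) = cos(j phi) with exp(i phi) replaced by any nonzero [z]. *)
Lemma chebT_joukowski z j : z != 0 ->
  (chebT C j).[(z + z^-1) / 2] = (z ^+ j + z ^- j) / 2.
Proof.
move=> z0; elim/nat_ind2: j => [||j IH0 IH1].
- by rewrite hornerC expr0 invr1; field.
- by rewrite hornerX !expr1.
rewrite chebTS !hornerR IH0 IH1 !exprS.
by field; rewrite z0 expf_neq0.
Qed.

Lemma size_lead_chebT j :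
  size (chebT C j) = j.+1 /\ lead_coef (chebT C j) = 2 ^+ j.-1.
Proof.
elim/nat_ind2: j => [||j [sz0 _] [sz1 lc1]].
- by rewrite size_poly1 lead_coef1.
- by rewrite size_polyX lead_coefX.
have n2 : (2 : C) != 0 by rewrite pnatr_eq0.
have sz : size (2 *: ('X * chebT C j.+1)) = j.+3.
  by rewrite size_scale // mulrC size_mulX ?sz1 // -size_poly_eq0 sz1.
rewrite chebTS size_polyDl ?lead_coefDl ?size_polyN ?sz ?sz0 //.
by rewrite lead_coefZ lead_coefM lead_coefX mul1r lc1 -exprS.
Qed.

Definition chebP j : {poly C} := 3 - 2 *: chebT C j.

Lemma size_lead_chebP j : (0 < j)%N ->
  size (chebP j) = j.+1 /\ lead_coef (chebP j) = - 2 ^+ j.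
Proof.
case: j => // j _; have [sz lc] := size_lead_chebT j.+1.
have n2 : (-2 : C) != 0 by rewrite oppr_eq0 pnatr_eq0.
have -> : chebP j.+1 = -2 *: chebT C j.+1 + 3%:P.
  by rewrite /chebP scaleNr polyC_natr addrC.
have sz' : size (-2 *: chebT C j.+1) = j.+2 by rewrite size_scale.
have lt3 : (size (3%:P : {poly C}) < size (-2 *: chebT C j.+1))%N.
  by rewrite sz' size_polyC; case: (_ != _).
by rewrite size_polyDl // lead_coefDl // sz' lead_coefZ lc mulNr -exprS.
Qed.

Lemma chebP_joukowski z j : z != 0 ->
  (chebP j).[(z + z^-1) / 2] = 3 - z ^+ j - z ^- j.
Proof.
move=> z0; rewrite /chebP -polyC_natr !hornerR chebT_joukowski //.
by field; rewrite expf_neq0.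
Qed.

Lemma joukowski1 : (1 + 1^-1) / 2 = 1 :> C.
Proof. by field. Qed.

Lemma chebT1 j : (chebT C j).[1] = 1.
Proof.
by rewrite -{1}joukowski1 chebT_joukowski ?oner_eq0 // expr1n joukowski1.
Qed.

Lemma chebP1 j : (chebP j).[1] = 1.
Proof. by rewrite /chebP -polyC_natr !hornerR chebT1; ring. Qed.

(** The source of the squares in the final denominator. *)
Lemma deriv_chebT1 j : (chebT C j)^`().[1] = j%:R ^+ 2.
Proof.
elim/nat_ind2: j => [||j IH0 IH1].
- by rewrite derivC hornerC expr0n.
- by rewrite derivX hornerC expr1n.
rewrite chebTS derivB derivZ derivM derivX !hornerR IH0 IH1 chebT1.
by rewrite -addn2 -[j.+1]addn1 !natrD; ring.
Qed.

Lemma deriv_chebP1 j : (chebP j)^`().[1] = -2 * j%:R ^+ 2.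
Proof.
by rewrite /chebP -polyC_natr derivB derivC derivZ !hornerR deriv_chebT1; ring.
Qed.

(** [w + r] and [w - r] are the roots of u^2 - 2 w u + 1, so they are mutually inverse. *)
Lemma joukowski_surj w : exists2 z : C, z != 0 & w = (z + z^-1) / 2.
Proof.
pose r := sqrtC (w ^+ 2 - 1).
have H : (w + r) * (w - r) = 1.
  by rewrite mulrC -subr_sqr sqrtCK; ring.
have u0 : w + r != 0.
  by apply: contra_eq_neq H => ->; rewrite mul0r eq_sym oner_eq0.
have uV : (w + r)^-1 = w - r by apply: (mulfI u0); rewrite mulfV.
by exists (w + r) => //; rewrite uV; field.
Qed.

(** * Products over roots of unity *)

Section RootOfUnity.
Variables (n : nat) (z : C).
Hypothesis zP : n.-primitive_root z.

Lemma prod_Xsub_prim_root x : \prod_(i < n) (x - z ^+ i) = x ^+ n - 1.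
Proof.
have := congr1 (fun p => p.[x]) (factor_Xn_sub_1 zP).
rewrite big_mkord horner_prod hornerD hornerN hornerXn hornerC => <-.
by apply: eq_bigr => i _; rewrite hornerXsubC.
Qed.

Let z_neq0 : z != 0.
Proof. by rewrite (prim_root_eq0 zP) -lt0n (prim_order_gt0 zP). Qed.

Lemma chebT_sub1_factor w :
  2 * (chebT C n).[w] - 2 =
  \prod_(i < n) (2 * (w - (z ^+ i + z ^- i) / 2)).
Proof.
have [u u0 ->] := joukowski_surj w; rewrite chebT_joukowski //.
(* Each factor splits by u + 1/u - v - 1/v = (u - v)(1/u - v)(-1/v), with v a root of unity. *)
have -> : \prod_(i < n) (2 * ((u + u^-1) / 2 - (z ^+ i + z ^- i) / 2)) =
    \prod_(i < n) ((u - z ^+ i) * (u^-1 - z ^+ i) * (- z ^- i)).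
  by apply: eq_bigr => i _; field; rewrite u0 expf_neq0.
rewrite !big_split /= !prod_Xsub_prim_root.
(* The inverse of [x ^+ n - 1] at [x = 0]. *)
have -> : \prod_(i < n) - z ^- i = -1.
  under eq_bigr do rewrite -invrN -sub0r.
  rewrite prodfV prod_Xsub_prim_root expr0n eqn0Ngt (prim_order_gt0 zP).
  by rewrite sub0r invrN invr1.
rewrite exprVn; field; exact: expf_neq0.
Qed.

End RootOfUnity.

(** Cancel ['X - 1] in the factorization of ['X^n.+1 - 1] and evaluate the geometric sum at 1. *)
Lemma prod_1sub_prim_root n z : n.+1.-primitive_root z ->
  \prod_(i < n) (1 - z ^+ i.+1) = n.+1%:R.
Proof.
move=> zP; have := factor_Xn_sub_1 zP.
rewrite big_mkord big_ord_recl expr0 subrX1.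
have X1 : 'X - 1%:P != 0 :> {poly C} by rewrite polyXsubC_eq0.
move=> /(mulfI X1)/(congr1 (fun p => p.[1])).
rewrite horner_prod horner_sum.
under [X in _ = X]eq_bigr do rewrite hornerXn expr1n.
rewrite sumr_const card_ord => <-.
by apply: eq_bigr => i _; rewrite hornerXsubC.
Qed.

Lemma norm_prod_joukowski_sub1 n z : n.+1.-primitive_root z ->
  \prod_(i < n) `|(z ^+ i.+1 + z ^- i.+1) / 2 - 1| = n.+1%:R ^+ 2 / 2 ^+ n :> C.
Proof.
move=> zP; have z1 : `|z| = 1.
  apply/eqP; rewrite -(@eqrXn2 _ n.+1) ?normr_ge0 ?ler01 //.
  by rewrite -normrX (prim_expr_order zP) normr1 expr1n.
have z0 : z != 0 by rewrite -normr_eq0 z1 oner_eq0.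
(* For |u| = 1, (u + 1/u) / 2 - 1 = (1 - u)^2 / (2u) has norm |1 - u|^2 / 2. *)
transitivity (\prod_(i < n) (`|1 - z ^+ i.+1| ^+ 2 / 2)).
  apply: eq_bigr => i _; set u := z ^+ i.+1.
  have u0 : u != 0 by rewrite expf_neq0.
  have -> : (u + u^-1) / 2 - 1 = (1 - u) ^+ 2 / (2 * u) by field.
  by rewrite normf_div normrX normrM normrX z1 expr1n mulr1 normr_nat.
by rewrite big_split /= prodr_const card_ord exprVn prodrXl -normr_prod
  (prod_1sub_prim_root zP) normr_nat.
Qed.

(** * The polynomial Q: degree, leading coefficient and value at 1 *)

Section YPoly.
Variables k l m : nat.
Hypotheses (k_gt0 : (0 < k)%N) (l_gt0 : (0 < l)%N) (m_gt0 : (0 < m)%N).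

Local Notation A := (chebP k).
Local Notation B := (chebP l).
Local Notation D := (chebP m).

(* The determinant of the Laplacian block at the frequency [z], as a
   polynomial in [w = (z + z^-1) / 2]. *)
Definition Ydet : {poly C} := 3 * (A * B * D) - (B * D + A * D + A * B).

Lemma horner_Ydet w : Ydet.[w] =
  3 * (A.[w] * B.[w] * D.[w]) - (B.[w] * D.[w] + A.[w] * D.[w] + A.[w] * B.[w]).
Proof.
rewrite /Ydet; move: A B D => a b d.
by rewrite -polyC_natr !(hornerD, hornerN, hornerM, hornerC).
Qed.

Lemma Ydet_joukowski z : z != 0 ->
  \det (star_mx 3 (Yweight k l m z)) = Ydet.[(z + z^-1) / 2].
Proof.
by move=> z0; rewrite det_star_mx horner_Ydet !chebP_joukowski.
Qed.

Definition Yquo : {poly C} := Ydet %/ ('X - 1).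

(** All three factors [chebP] equal 1 at 1, so [Ydet] vanishes there as 3 - 3. *)
Lemma YquoK : Ydet = Yquo * ('X - 1).
Proof.
rewrite /Yquo divpK // -[1]/(1%:P) dvdp_XsubCl /root horner_Ydet.
by rewrite !chebP1; apply/eqP; ring.
Qed.

(** The triple product dominates: each pairwise product lacks one factor of positive degree. *)
Lemma size_lead_Ydet :
  size Ydet = (k + l + m).+1 /\ lead_coef Ydet = - 3 * 2 ^+ (k + l + m).
Proof.
have [szA lcA] := size_lead_chebP k_gt0.
have [szB lcB] := size_lead_chebP l_gt0.
have [szD lcD] := size_lead_chebP m_gt0.
have nz (p : {poly C}) j : size p = j.+1 -> p != 0.
  by move=> sz; rewrite -size_poly_eq0 sz.
have sz2 (p q : {poly C}) i j : size p = i.+1 -> size q = j.+1 ->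
    size (p * q) = (i + j).+1.
  move=> szp szq; rewrite size_mul ?(nz _ _ szp) ?(nz _ _ szq) //.
  by rewrite szp szq addSn addnS.
have szABD := sz2 _ _ _ _ (sz2 _ _ _ _ szA szB) szD.
have n3 : (3 : C) != 0 by rewrite pnatr_eq0.
have E3 : 3 * (A * B * D) = 3 *: (A * B * D) by rewrite -mul_polyC polyC_natr.
have sz3 : size (3 * (A * B * D)) = (k + l + m).+1.
  by rewrite E3 size_scale.
have small : (size (- (B * D + A * D + A * B))%R < size (3 * (A * B * D))%R)%N.
  rewrite size_polyN sz3 ltnS; apply: leq_trans (size_polyD _ _) _.
  rewrite geq_max; apply/andP; split.
    apply: leq_trans (size_polyD _ _) _.
    rewrite geq_max (sz2 _ _ _ _ szB szD) (sz2 _ _ _ _ szA szD); lia.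
  rewrite (sz2 _ _ _ _ szA szB); lia.
rewrite /Ydet size_polyDl // lead_coefDl // sz3 E3 lead_coefZ !lead_coefM.
rewrite lcA lcB lcD.
by split=> //; rewrite !exprD; ring.
Qed.

Lemma size_Yquo : size Yquo = (k + l + m)%N.
Proof.
have [sz _] := size_lead_Ydet.
have Q0 : Yquo != 0.
  by apply/eqP=> Q0; rewrite YquoK Q0 mul0r size_poly0 in sz.
move: sz; rewrite YquoK -[1]/(1%:P) size_Mmonic ?monicXsubC // size_XsubC.
by rewrite addn2 => -[].
Qed.

Lemma lead_Yquo : lead_coef Yquo = - 3 * 2 ^+ (k + l + m).
Proof.
have [_ <-] := size_lead_Ydet.
by rewrite [in RHS]YquoK -[1]/(1%:P) lead_coef_Mmonic ?monicXsubC.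
Qed.

(** The value is the derivative of [Ydet = Yquo * ('X - 1)] at 1, computed from the values and
    derivatives of the [chebP]. *)
Lemma Yquo1 : Yquo.[1] = - 2 * (k ^ 2 + l ^ 2 + m ^ 2)%:R.
Proof.
have <- : Ydet^`().[1] = Yquo.[1].
  rewrite YquoK; move: Yquo => q; rewrite derivM derivB derivX derivC subr0 mulr1.
  by rewrite hornerD hornerM hornerXsubC subrr mulr0 add0r.
move: (chebP1 k) (chebP1 l) (chebP1 m).
move: (deriv_chebP1 k) (deriv_chebP1 l) (deriv_chebP1 m).
rewrite /Ydet; move: A B D => a b d da db dd a1 b1 d1.
rewrite -polyC_natr !(derivB, derivD, derivM, derivC).
rewrite !(hornerD, hornerN, hornerM, hornerC) da db dd a1 b1 d1 !natrD !natrX.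
ring.
Qed.

Lemma tofrac_Yquo : FracField.tofrac Yquo = Yfrac C k l m.
Proof.
have tofrac_neq0 j : (0 < j)%N -> chebA C j != 0.
  move=> j0; rewrite /chebA tofrac_eq0 -size_poly_eq0.
  by have [-> _] := size_lead_chebP j0.
have X1 : FracField.tofrac ('X - 1 : {poly C}) != 0.
  by rewrite tofrac_eq0 polyXsubC_eq0.
apply: (mulIf X1); rewrite -rmorphM -YquoK /Yfrac.
rewrite mulrAC divfK //.
rewrite /Ydet rmorphB !rmorphD !rmorphM rmorph_nat -!/(chebA C _).
by rewrite -star_det_fieldE ?tofrac_neq0.
Qed.

End YPoly.

End Chebyshev.

(** * Exchanging roots of Q and roots of unity *)

Section Roots.
Variables (C : numClosedFieldType) (k l m n : nat) (z : C).
Hypotheses (k_gt0 : (0 < k)%N) (l_gt0 : (0 < l)%N) (m_gt0 : (0 < m)%N).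
Hypothesis zP : n.+1.-primitive_root z.

Local Notation s := (k + l + m - 1)%N.
Local Notation omega i := ((z ^+ i + z ^- i) / 2).
Local Notation Q := (Yquo C k l m).

Lemma spanning_trees_prod_Yquo :
  (n.+1 * num_spanning_trees (Ygraph n.+1 k l m))%:R =
  n.+1%:R ^+ 2 / 2 ^+ n * \prod_(i < n) `|Q.[omega i.+1]| :> C.
Proof.
have z0 : z != 0 by rewrite (prim_root_eq0 zP).
have n4 : (4 : C) != 0 by rewrite pnatr_eq0.
have := Y_tree_count k l m zP; rewrite -mulnA natrM => /(mulfI n4) H.
(* The count is its own norm; the factors [omega i.+1 - 1] account for the constant. *)
rewrite -[LHS]normr_nat H normr_prod -(norm_prod_joukowski_sub1 zP) -big_split /=.
apply: eq_bigr => i _.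
rewrite Ydet_joukowski ?expf_neq0 // YquoK -[X in 'X - X]/(1%:P) hornerM.
by rewrite hornerXsubC normrM mulrC.
Qed.

Lemma prod_chebT_roots (w : 'I_s -> C) :
  Q = lead_coef Q *: \prod_(p < s) ('X - (w p)%:P) ->
  \prod_(p < s) `|2 * (chebT C n.+1).[w p] - 2| =
  2 * (k ^ 2 + l ^ 2 + m ^ 2)%:R / 6 ^+ n.+1 * \prod_(i < n) `|Q.[omega i.+1]|.
Proof.
move=> Qw.
(* The leading coefficient has norm 3 * 2^(s+1): 2^s goes into the [s] factors and 6 remains. *)
have Q_eval x : `|Q.[x]| = 6 * \prod_(p < s) `|2 * (w p - x)|.
  rewrite {1}Qw hornerZ normrM lead_Yquo // horner_prod normr_prod.
  under [X in _ = _ * X]eq_bigr do rewrite normrM distrC normr_nat.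
  rewrite big_split /= prodr_const card_ord mulrA; congr (_ * _); last first.
    by apply: eq_bigr => p _; rewrite hornerXsubC.
  rewrite mulNr normrN normrM normrX !normr_nat.
  have -> : 2 ^+ (k + l + m) = 2 * 2 ^+ s :> C.
    by rewrite -exprS; congr (_ ^+ _); lia.
  by ring.
have n6 : (6 : C) != 0 by rewrite pnatr_eq0.
under eq_bigr do rewrite (chebT_sub1_factor zP) normr_prod.
rewrite exchange_big /=.
under eq_bigr => i _.
  have -> : \prod_(p < s) `|2 * (w p - omega i)| = `|Q.[omega i]| / 6.
    by rewrite Q_eval mulrAC mulfV // mul1r.
  over.
(* The index 0 gives [omega 0 = 1], hence the separate factor Q(1). *)
rewrite big_split /= prodr_const card_ord exprVn big_ord_recl expr0.
rewrite joukowski1 Yquo1 mulNr normrN normrM !normr_nat.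
by rewrite mulrAC.
Qed.

End Roots.

Theorem theorem3 (C : numClosedFieldType) (n k l m : nat)
    (n_gt0 : (0 < n)%N) (k_gt0 : (0 < k)%N) (l_gt0 : (0 < l)%N)
    (m_gt0 : (0 < m)%N)
    (gcd1 : gcdn (gcdn (gcdn k l) m) n = 1%N) :
  let s := (k + l + m - 1)%N in
  exists Q : {poly C},
    [/\ FracField.tofrac Q = Yfrac C k l m,
        size Q = s.+1
      & forall w : 'I_s -> C,
          Q = lead_coef Q *: \prod_(p < s) ('X - (w p)%:P) ->
          (num_spanning_trees (Ygraph n k l m))%:R =
            n%:R * 3 ^+ n / (k ^ 2 + l ^ 2 + m ^ 2)%:R
            * \prod_(p < s) `|2 * (chebT C n).[w p] - 2|].
Proof.
move=> s; exists (Yquo C k l m); split.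
- exact: tofrac_Yquo.
- by rewrite size_Yquo // /s; lia.
move=> w Qw; case: n n_gt0 {gcd1} => // n _.
have [z zP] := prim_root_exists C (ltn0Sn n).
rewrite (prod_chebT_roots k_gt0 l_gt0 m_gt0 zP Qw).
have n0 : n.+1%:R != 0 :> C by rewrite pnatr_eq0.
apply: (mulfI n0); rewrite -[LHS]natrM.
rewrite (spanning_trees_prod_Yquo k l m zP).
have K0 : (k ^ 2 + l ^ 2 + m ^ 2)%:R != 0 :> C.
  by rewrite pnatr_eq0 -lt0n addn_gt0 expn_gt0 m_gt0 orbT.
move: K0 n0; set K := (_ + m ^ 2)%:R; move: K (n.+1%:R) (\prod_(_ < n) _).
move=> K N P K0 N0.
(* Splitting the power of 6 cancels 3^n and leaves the 2^n of the tree count. *)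
have -> : 6 ^+ n.+1 = 6 * (3 ^+ n * 2 ^+ n) :> C.
  by rewrite exprS -exprMn; congr (_ * _ ^+ _); ring.
rewrite (exprS 3); field.
by rewrite K0 !expf_neq0 // pnatr_eq0.
Qed.
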